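(* Let $D$ be an eulerian digraph with $n$ vertices and $m$ arcs. If $D$ has a directed embedding with $t$ faces, then $D$ has a nonorientable directed embedding with $s$ faces for every $s$ with $1\le s<t$; consequently, the set of genera for which $D$ has a nonorientable directed embedding is a (possibly empty) interval of integers. If $D$ has no arcs, then $D$ has exactly one directed embedding, which is planar with exactly one face. If $D$ has at least one arc, then $D$ has at least one directed embedding with exactly one face, every such embedding is nonorientable, and every such embedding has maximum genus, namely $m-n+1$, over all nonorientable directed embeddings of $D$, and also maximum Euler genus over all directed embeddings of $D$.
   Context: Digraphs are finite and may have loops and multiple arcs. A digraph is eulerian if it has a directed circuit using every arc and every vertex. Embeddings are cellular in closed surfaces. A directed embedding of a digraph is an embedding in which every face is bounded by a directed closed walk. The Euler genus of a surface is its genus if nonorientable and twice its genus if orientable. *)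

(* Defs.v *)
From mathcomp Require Import all_boot all_order all_algebra.

Set Implicit Arguments.
Unset Strict Implicit.
Unset Printing Implicit Defensive.

Import Order.TTheory GRing.Theory Num.Theory.
Record digraph := Digraph {
  vert : finType;
  darc : finType;
  src : darc -> vert;
  tgt : darc -> vert
}.

Fixpoint diwalk (D : digraph) (u : vert D) (p : seq (darc D)) (v : vert D) :
    bool :=
  if p is a :: p' then (src a == u) && diwalk (tgt a) p' v else u == v.

(* A circuit is a closed walk without repeated arcs.  The empty circuit at u
   uses the vertex u only, so a single vertex without arcs is eulerian. *)
Definition eulerian (D : digraph) : Prop :=
  exists (u : vert D) (p : seq (darc D)),
    [/\ diwalk u p u, uniq p, (forall a : darc D, a \in p)
      & (forall v : vert D, v \in u :: map (@tgt D) p)].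

(* Cellular embeddings in closed surfaces are encoded, up to homeomorphism, by
   their flags (Tutte).  Thicken the embedded digraph to a ribbon graph: each
   arc becomes a rectangle with two ends and two long sides, the sides being
   labelled arbitrarily by booleans.  The flag (a, h, s) is the corner of the
   rectangle of a on side s, at the head of a if h and at its tail otherwise. *)
Definition flag (D : digraph) : finType := (darc D * bool * bool)%type.

Definition flag_vertex (D : digraph) (x : flag D) : vert D :=
  let: (a, h, _) := x in if h then tgt a else src a.

Definition along (D : digraph) (x : flag D) : flag D :=
  let: (a, h, s) := x in (a, ~~ h, s).

Definition across (D : digraph) (x : flag D) : flag D :=
  let: (a, h, s) := x in (a, h, ~~ s).

Definition adj2 (T : eqType) (f g : T -> T) : rel T :=
  [rel x y | (y == f x) || (y == g x)].

(* Around a vertex one alternately crosses the end of an arc (across) and the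
   angle of a face between two consecutive arc-ends (corner).  The last axiom
   says that this closes up to exactly one cycle around each vertex: the
   rotation.  As sides are carried along arcs, the way corner matches the sides
   also records which arcs are twisted. *)
Record embedding (D : digraph) := Embedding {
  corner : flag D -> flag D;
  cornerK : involutive corner;
  corner_neq : forall x, corner x != x;
  corner_vertex : forall x y : flag D,
    connect (adj2 corner (@across D)) x y = (flag_vertex x == flag_vertex y)
}.

(* Embeddings that differ by the arbitrary labelling of the sides of the arcs,
   i.e. by a homeomorphism fixing every vertex and every arc. *)
Definition relabel (D : digraph) (h : darc D -> bool) (x : flag D) : flag D :=
  let: (a, e, s) := x in (a, e, s (+) h a).

Definition emb_equiv (D : digraph) (E1 E2 : embedding D) : Prop :=
  exists h : darc D -> bool,
    forall x, corner E2 (relabel h x) = relabel h (corner E1 x).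

(* The faces incident with some arc, as sets of flags. *)
Definition faces (D : digraph) (E : embedding D) : {set {set flag D}} :=
  [set [set y | connect (adj2 (corner E) (@along D)) x y] | x : flag D].

Definition isolated (D : digraph) : {set vert D} :=
  [set v | [forall a : darc D, (src a != v) && (tgt a != v)]].

(* An isolated vertex has no flags: it lies on a sphere, in a single face
   bounded by the trivial walk. *)
Definition nfaces (D : digraph) (E : embedding D) : nat :=
  #|faces E| + #|isolated D|.

Definition face_step (D : digraph) (E : embedding D) (x : flag D) : flag D :=
  corner E (along x).

(* The closed walk around a face, as a sequence of pairs (a, h): the arc a is
   left from its tail (traversed forwards) if h is false, and from its head
   (traversed backwards) if h is true. *)
Definition facial_walk (D : digraph) (E : embedding D) (x : flag D) :
    seq (darc D * bool) :=
  [seq y.1 | y <- orbit (face_step E) x].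

(* Only the faces of [faces E] need a condition: a trivial walk is directed. *)
Definition directed_emb (D : digraph) (E : embedding D) : Prop :=
  forall F, F \in faces E ->
    exists2 x, x \in F & all (fun d => ~~ d.2) (facial_walk E x).

(* Locally consistent orientations: the flags are 2-coloured so that flags
   exchanged by any of the three involutions have different colours. *)
Definition orientable (D : digraph) (E : embedding D) : bool :=
  [exists c : {ffun flag D -> bool}, [forall x : flag D,
    [&& c (along x) == ~~ c x, c (across x) == ~~ c x
      & c (corner E x) == ~~ c x]]].

Local Open Scope ring_scope.

Definition euler_char (D : digraph) (E : embedding D) : int :=
  #|vert D|%:Z - #|darc D|%:Z + (nfaces E)%:Z.

(* The genus of the surface, for a connected digraph: the Euler characteristic
   is 2 - 2 g if the surface is orientable (so the division is exact), and
   2 - g otherwise. *)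
Definition genus (D : digraph) (E : embedding D) : int :=
  if orientable E then ((2 - euler_char E) %/ 2)%Z else 2 - euler_char E.

Definition euler_genus (D : digraph) (E : embedding D) : int :=
  if orientable E then 2 * genus E else genus E.

Definition planar (D : digraph) (E : embedding D) : Prop :=
  orientable E /\ genus E = 0.

Definition nonor_directed_genus (D : digraph) (g : int) : Prop :=
  exists E : embedding D,
    [/\ directed_emb E, ~~ orientable E & genus E = g].

(* Main.v *)
Require Import Defs.
From mathcomp Require Import all_boot all_order all_algebra.
From mathcomp Require Import perm fingroup zify.
Import Order.TTheory GRing.Theory Num.Theory.

(* A directed embedding amounts to a permutation of the sides of the arcs
   (following a face from the side of one arc to that of the next), whose cycles
   are the nontrivial faces.  Twisting an arc at its head multiplies this
   permutation by the transposition of its two sides and does not change which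
   arc-ends are neighbours around a vertex.  If there are at least two faces,
   connectivity gives an arc between two different ones; twisting it merges them,
   and the result is nonorientable because a face now runs along both sides of
   this arc in the same direction.  Hence the number of faces can be decreased
   one by one down to 1, and the genera follow from Euler's formula.  A directed
   embedding to start from is read off an euler circuit. *)

(** * Reachability, rotations of fibres and Euler circuits *)

Lemma connect_inv (T : finType) (U : Type) (e : rel T) (f : T -> U) (x y : T) :
  (forall x y, e x y -> f x = f y) -> connect e x y -> f x = f y.
Proof.
move=> ef /connectP[p]; elim: p x => [x _ -> //|z p IHp x /= /andP[exz pz] yE].
by rewrite (ef _ _ exz); apply: IHp.
Qed.

Lemma adj2_connect_sym {T : finType} {f g : T -> T} :
  involutive f -> involutive g -> connect_sym (adj2 f g).
Proof.
move=> fK gK; apply: sym_connect_sym => x y; rewrite /adj2 /=.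
by rewrite ![y == _]eq_sym (inv_eq fK) (inv_eq gK).
Qed.

Lemma connect_adj2l {T : finType} {f g : T -> T} x : connect (adj2 f g) x (f x).
Proof. by apply: connect1; rewrite /adj2 /= eqxx. Qed.

Lemma connect_adj2r {T : finType} {f g : T -> T} x : connect (adj2 f g) x (g x).
Proof. by apply: connect1; rewrite /adj2 /= eqxx orbT. Qed.

(** Each fibre is listed, and every element is sent to its cyclic successor in the list. Applied to
    [tgt], this rotates the arcs entering each vertex. *)
Lemma fiber_rotation (T : finType) (U : eqType) (f : T -> U) :
  exists s : {perm T}, forall x y, fconnect s x y = (f x == f y).
Proof.
pose fib u := enum [pred y | f y == u].
have mem_fib x u : (x \in fib u) = (f x == u) by rewrite mem_enum.
pose r x := next (fib (f x)) x.
have fr x : f (r x) = f x.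
  by apply/eqP; rewrite -(mem_fib (r x)) mem_next mem_fib.
have r_inj : injective r.
  move=> x y rE; have fE : f x = f y by rewrite -fr rE fr.
  by apply: (can_inj (prev_next (enum_uniq [pred z | f z == f y]))); rewrite -[RHS]rE /r fE.
exists (perm r_inj) => x y.
rewrite (eq_fconnect (permE r_inj)) (@fconnect_cycle _ _ (fib (f x))) ?mem_fib 1?eq_sym //.
rewrite -(@eq_in_cycle _ (mem (fib (f x))) (frel (next (fib (f x))))) //.
  exact/cycle_next/enum_uniq.
by move=> u v; rewrite [u \in _]mem_fib => /eqP fu _; rewrite /= /r fu.
Qed.

Lemma diwalk_path (D : digraph) (u v : vert D) (a : darc D) p :
  diwalk u (a :: p) v =
  [&& src a == u, path (fun b c => tgt b == src c) a p & tgt (last a p) == v].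
Proof.
elim: p a u => [|b p IHp] a u //=; rewrite -/(diwalk (tgt a) (b :: p) v) IHp /=.
by rewrite -andbA [src b == _]eq_sym.
Qed.

Lemma eulerian_cycle {D : digraph} : eulerian D ->
  exists p : seq (darc D), [/\ path.cycle (fun b c => tgt b == src c) p, uniq p &
    forall a, a \in p].
Proof.
case=> u [[|a p] [walk Up allp _]]; first by exists [::].
exists (a :: p); split=> //.
move: walk; rewrite diwalk_path /= rcons_path => /and3P[/eqP <- -> /eqP->].
by rewrite /= eqxx.
Qed.

Lemma eulerian_isolated {D : digraph} :
  eulerian D -> (0 < #|darc D|)%N -> isolated D = set0.
Proof.
case=> u [p [walk Up allp allv]] /card_gt0P[a0 _].
apply/setP=> v; rewrite !inE; apply/negP => /forallP v_iso.
case: p => [|a p] in walk Up allp allv; first by have := allp a0.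
move: (allv v); rewrite inE => /orP[/eqP vu|/mapP[b _ vE]].
  by move: (v_iso a) walk; rewrite diwalk_path vu => /andP[/negPf-> _].
by move: (v_iso b); rewrite vE eqxx andbF.
Qed.

Lemma eulerian_no_arc {D : digraph} :
  eulerian D -> #|darc D| = 0%N -> #|vert D| = 1%N /\ isolated D = setT.
Proof.
case=> u [p [walk Up allp allv]] /card0_eq m0.
have no_arc (a : darc D) : False by have := m0 a.
split; last by apply/setP=> v; rewrite !inE; apply/forallP=> a; case: (no_arc a).
case: p => [|a p] in walk Up allp allv; last by case: (no_arc a).
by apply/eqP/fintype1P; exists u => v; apply/eqP; have := allv v; rewrite inE.
Qed.

(** * Corners and sides in directed embeddings *)

Section Basics.

Context {D : digraph}.
Implicit Types (x y : flag D) (E : embedding D).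

Lemma alongK : involutive (@along D). Proof. by case=> [[a h] s] /=; rewrite negbK. Qed.
Lemma acrossK : involutive (@across D). Proof. by case=> [[a h] s] /=; rewrite negbK. Qed.

Lemma across_vertex x : flag_vertex (across x) = flag_vertex x.
Proof. by case: x => [[a h] s]. Qed.

Lemma face_step_inj E : injective (face_step E).
Proof. exact: inj_comp (inv_inj (cornerK E)) (inv_inj alongK). Qed.

Lemma face_step_connect E x y :
  fconnect (face_step E) x y -> connect (adj2 (corner E) (@along D)) x y.
Proof.
apply: connect_sub => {}x _ /eqP <-.
exact: connect_trans (connect_adj2r x) (connect_adj2l _).
Qed.

(** A directed face reaches each corner by a head and leaves it by a tail, so directedness becomes a
    local condition on [corner]. *)
Lemma directed_embP {E} : directed_emb E <-> forall x, (corner E x).1.2 = ~~ x.1.2.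
Proof.
have cK := cornerK E; have sK := adj2_connect_sym cK alongK.
split=> [dirE x|dirE F /imsetP[x _ ->]]; last first.
  have [y yx yt] : exists2 y, y \in [:: x; along x] & ~~ y.1.2.
    by case: x => [[a [|]] s]; [exists (a, false, s)|exists (a, false, s)];
       rewrite ?inE ?eqxx ?orbT.
  exists y; first by move: yx; rewrite !inE => /orP[]/eqP->; rewrite ?connect0 ?connect_adj2r.
  rewrite all_map; apply/allP => z /=; rewrite -fconnect_orbit.
  move=> /(@connect_inv _ _ _ (fun z => z.1.2)) <- //.
  move=> {}z w /eqP <-; rewrite /face_step dirE.
  by case: z => [[a []] s].
have /dirE[z] : [set y | connect (adj2 (corner E) (@along D)) x y] \in faces E.
  exact: imset_f.
rewrite inE sK => zx; rewrite all_map => /allP dz.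
have {}dz y : fconnect (face_step E) z y -> ~~ y.1.2.
  by rewrite fconnect_orbit => /dz.
(* The flags of the directed walk from [z] and their [along] partners form a set closed under both
   involutions, hence containing the whole face. *)
pose P := [pred y | fconnect (face_step E) z y || fconnect (face_step E) z (along y)].
have back y : fconnect (face_step E) z y ->
    exists2 w, fconnect (face_step E) z w & corner E y = along w.
  move=> zy; have yE := f_finv (face_step_inj E) y.
  exists (finv (face_step E) y); last by rewrite -[in LHS]yE /face_step cK.
  exact: connect_trans zy (fconnect_finv _ _).
have {zx} : x \in P.
  rewrite -(@closed_connect _ (adj2 (corner E) (@along D)) P _ _ _ zx) ?inE ?connect0 //.
  apply: intro_closed => // {zx}y w /=.
  rewrite !inE => /orP[]/eqP-> /orP[].
  - by move=> /back[v zv ->]; rewrite alongK zv orbT.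
  - move=> zy; apply/orP; left; apply: connect_trans zy _.
    by rewrite -{2}[y]alongK fconnect1.
  - by move=> zy; rewrite alongK zy orbT.
  - by move=> ->.
(* Either [x] is a tail in the walk and its corner is the preceding head, or [along x] is in the
   walk, [x] is a head and its corner is the next tail. *)
rewrite inE => /orP[zx|zx].
  have [w zw ->] := back x zx; move: (dz _ zx) (dz _ zw).
  by case: w {zw} => [[a []] s] //= /negPf->.
have /dz/negPf : fconnect (face_step E) z (corner E x).
  by apply: connect_trans zx _; rewrite -{2}[x]alongK fconnect1.
by move=> ->; move: (dz _ zx); case: x {zx} => [[a []] s].
Qed.

(** In a directed embedding each side of an arc is followed from tail to head, so its tail flag can
    stand for it. *)
Definition tail_flag (p : darc D * bool) : flag D := (p.1, false, p.2).
Definition side (x : flag D) : darc D * bool := (x.1.1, x.2).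

Lemma side_along x : side (along x) = side x.
Proof. by case: x => [[a h] s]. Qed.

Lemma tail_flagK : cancel tail_flag side.
Proof. by case. Qed.

Lemma sideK x : ~~ x.1.2 -> tail_flag (side x) = x.
Proof. by case: x => [[a []] s]. Qed.

End Basics.

(** * The permutation of arc sides traced by the faces *)

Section FacePerm.

Context {D : digraph} {E : embedding D}.
Hypothesis dirE : directed_emb E.
Implicit Types (x y : flag D) (p q : darc D * bool).

Definition face_map p := side (face_step E (tail_flag p)).

Lemma tail_face_map p : tail_flag (face_map p) = face_step E (tail_flag p).
Proof. by rewrite sideK // (iffLR directed_embP). Qed.

Lemma face_map_inj : injective face_map.
Proof.
move=> p q /(congr1 tail_flag); rewrite !tail_face_map.
by move=> /(face_step_inj E)/(can_inj tail_flagK).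
Qed.

Definition face_perm : {perm darc D * bool} := perm face_map_inj.

Lemma tail_face_perm p : tail_flag (face_perm p) = face_step E (tail_flag p).
Proof. by rewrite permE tail_face_map. Qed.

(** At a head, the corner leads to the next side of the same face; the tail case follows since
    [corner] is an involution. *)
Lemma porbit_corner x : porbit face_perm (side (corner E x)) = porbit face_perm (side x).
Proof.
wlog xh : x / x.1.2.
  move=> IH; case xh: x.1.2; first exact: IH.
  by have := IH (corner E x); rewrite cornerK (iffLR directed_embP) ?xh // => ->.
have xE : along x = tail_flag (side x) by case: x xh => [[a []] s].
rewrite -[in LHS](alongK x) xE -/(face_step E _) -tail_face_perm tail_flagK.
exact: (porbit_perm _ 1).
Qed.

Lemma face_connectE p q :
  connect (adj2 (corner E) (@along D)) (tail_flag p) (tail_flag q)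
  = (q \in porbit face_perm p).
Proof.
rewrite -eq_porbit_mem; apply/idP/idP => [|/eqP pq].
  move/(@connect_inv _ _ _ (fun x => porbit face_perm (side x))); rewrite !tail_flagK => -> //.
  by move=> x y /= /orP[]/eqP->; rewrite ?side_along ?porbit_corner.
have /porbitP[i ->] : q \in porbit face_perm p by rewrite -pq porbit_id.
elim: i {pq q} => [|i IHi]; first by rewrite expg0 perm1.
apply: connect_trans IHi _; apply: face_step_connect.
by rewrite expgSr permM tail_face_perm fconnect1.
Qed.

(** A face corresponds to the set of sides whose tail flags it contains; this loses nothing, as
    every flag shares a face with the tail flag of its side. *)
Lemma card_faces : #|faces E| = #|porbits face_perm|.
Proof.
pose h (F : {set flag D}) := [set p | tail_flag p \in F].
have sK := adj2_connect_sym (cornerK E) alongK.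
pose cl x := [set y | connect (adj2 (corner E) (@along D)) x y].
have clE x : cl x = cl (tail_flag (side x)).
  apply/setP=> y; rewrite !inE; apply: (same_connect sK).
  case: x => [[a []] s]; last exact: connect0.
  exact: connect_adj2r.
have hcl p : h (cl (tail_flag p)) = porbit face_perm p.
  by apply/setP=> q; rewrite !inE face_connectE.
have -> : porbits face_perm = h @: faces E.
  rewrite /faces -imset_comp; apply/setP=> O; apply/imsetP/imsetP => -[p _ ->].
    by exists (tail_flag p); rewrite //= -/(cl _) hcl.
  by exists (side p); rewrite //= -/(cl _) clE hcl.
rewrite [RHS]card_in_imset // => _ _ /imsetP[x _ ->] /imsetP[y _ ->].
rewrite -/(cl x) -/(cl y) (clE x) (clE y) !hcl => pE.
apply/setP=> z; rewrite !inE; apply: (same_connect sK).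
by rewrite face_connectE pE porbit_id.
Qed.

(* Two steps of a face (along, corner) restore the colour, whereas crossing an
   arc changes it: so in a directed orientable embedding no face lies on both
   sides of an arc. *)
Lemma directed_nonorientable a :
  (a, true) \in porbit face_perm (a, false) -> ~~ orientable E.
Proof.
move=> /porbitP[i aE]; apply/existsP=> -[c /forallP cP].
have /and3P[_ /eqP ca _] := cP (a, false, false).
have ct p : c (tail_flag (face_perm p)) = c (tail_flag p).
  rewrite tail_face_perm; have /and3P[/eqP al _ _] := cP (tail_flag p).
  by have /and3P[_ _ /eqP->] := cP (along (tail_flag p)); rewrite al negbK.
have : c (tail_flag (a, true)) = c (tail_flag (a, false)).
  by rewrite aE; elim: i {aE} => [|i IHi]; rewrite ?expg0 ?perm1 // expgSr permM ct.
by move: ca; rewrite /= /tail_flag /= => ->; case: (c _).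
Qed.

End FacePerm.

(** * Twisting an arc at its head *)

Section Twist.

Context {D : digraph}.
Implicit Types (x y : flag D) (E : embedding D) (a : darc D).

(** Conjugating [corner] by this exchange gives the arc [a] a half-twist. *)
Definition swap_head a x : flag D := if x.1 == (a, true) then across x else x.

Lemma swap_headK a : involutive (swap_head a).
Proof.
move=> x; rewrite /swap_head; case xa: (x.1 == _); last by rewrite xa.
by case: x xa => [[b h] s] /= ->; rewrite negbK.
Qed.

Lemma swap_head_side a x : (swap_head a x).1 = x.1.
Proof. by rewrite /swap_head; case: ifP => //; case: x => [[b h] s]. Qed.

Lemma swap_head_connect a (f : flag D -> flag D) x :
  connect (adj2 f (@across D)) x (swap_head a x).
Proof. by rewrite /swap_head; case: ifP; rewrite ?connect0 // connect_adj2r. Qed.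

Definition twist_corner a (f : flag D -> flag D) x := swap_head a (f (swap_head a x)).

Lemma twist_cornerK a f : involutive f -> involutive (twist_corner a f).
Proof. by move=> fK x; rewrite /twist_corner swap_headK fK swap_headK. Qed.

Lemma twist_corner2 a f : twist_corner a (twist_corner a f) =1 f.
Proof. by move=> x; rewrite /twist_corner !swap_headK. Qed.

Lemma twist_corner_neq E a x : twist_corner a (corner E) x != x.
Proof. by rewrite /twist_corner (inv_eq (swap_headK a)) corner_neq. Qed.

(** Exchanged flags differ by [across], so each twisted step is replaced by a path of untwisted
    ones. *)
Lemma twist_corner_sub a f :
  subrel (connect (adj2 (twist_corner a f) (@across D))) (connect (adj2 f (@across D))).
Proof.
apply: connect_sub => x y /orP[]/eqP->; last exact: connect_adj2r.
apply: connect_trans (swap_head_connect a f _) _.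
exact: connect_trans (connect_adj2l _) (swap_head_connect a f _).
Qed.

Lemma twist_corner_vertex E a x y :
  connect (adj2 (twist_corner a (corner E)) (@across D)) x y
  = (flag_vertex x == flag_vertex y).
Proof.
rewrite -(corner_vertex E); apply/idP/idP; first exact: twist_corner_sub.
(* Twisting twice is the identity, so the converse is the same inclusion applied to the twisted
   corner. *)
rewrite -(eq_connect (e := adj2 (twist_corner a (twist_corner a (corner E))) (@across D))).
  exact: twist_corner_sub.
by move=> u v; rewrite /adj2 /= twist_corner2.
Qed.

Definition twist a E :=
  Embedding (twist_cornerK a _ (cornerK E)) (twist_corner_neq E a)
            (twist_corner_vertex E a).

Lemma twist_directed a E : directed_emb E -> directed_emb (twist a E).
Proof.
move=> /directed_embP dirE; apply/directed_embP => x /=.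
by rewrite /twist_corner swap_head_side dirE swap_head_side.
Qed.

(** A face reaching the head of [a] continues from the other side. The exchange after [corner] has
    no effect, because the corner of a head is a tail. *)
Lemma twist_face_perm a E (dirE : directed_emb E) :
  face_perm (twist_directed a E dirE)
  = (tperm (a, false) (a, true) * face_perm dirE)%g.
Proof.
apply/permP=> p; apply: (can_inj tail_flagK); rewrite permM !tail_face_perm.
have tE : swap_head a (along (tail_flag p))
          = along (tail_flag (tperm (a, false) (a, true) p)).
  rewrite /swap_head; case: p => b s /=; case: eqP => [[->]|ba].
    by case: s; rewrite ?tpermL ?tpermR.
  by rewrite tpermD //; apply/eqP => -[ab _]; case: ba; rewrite ab.
rewrite /face_step /= /twist_corner tE /swap_head; case: eqP => // /(congr1 snd).
by rewrite (iffLR directed_embP).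
Qed.

(* Twisting an arc that separates two faces merges them; the arc then has the
   same face on both sides, which forces nonorientability. *)
Lemma twist_merge a E (dirE : directed_emb E) :
  (a, true) \notin porbit (face_perm dirE) (a, false) ->
  #|faces E| = #|faces (twist a E)|.+1 /\ ~~ orientable (twist a E).
Proof.
rewrite porbit_sym => a_sep.
have := porbits_mul_tperm (face_perm dirE) (a, false) (a, true).
(* A second twist restores the permutation; comparing the two orbit counts forces both sides of [a]
   into one orbit after the first twist. *)
have := porbits_mul_tperm (face_perm (twist_directed a E dirE)) (a, false) (a, true).
rewrite /= {1}twist_face_perm mulgA tperm2 mul1g a_sep -twist_face_perm -!card_faces.
rewrite porbit_sym xpair_eqE eqxx /=; set b := _ \notin _ => eqb eqN.
have b0 : b = false by move: eqb eqN; case: b => //=; lia.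
split; first by move: eqb eqN; rewrite b0 /=; lia.
by apply: (directed_nonorientable (twist_directed a E dirE) a); apply/negbFE.
Qed.

End Twist.

(** * Existence of separating arcs and of directed embeddings *)

(** Otherwise [across], like [corner] and [along], preserves the face; it is then constant around
    each vertex and, following the Euler circuit, everywhere. *)
Lemma separating_arc {D : digraph} {E : embedding D} (dirE : directed_emb E) :
  eulerian D -> (1 < #|faces E|)%N ->
  exists a, (a, true) \notin porbit (face_perm dirE) (a, false).
Proof.
move=> /eulerian_cycle[c [cyc _ allc]] E2; apply/existsP.
apply: contraLR E2 => /existsPn/= same; rewrite -leqNgt card_faces.
pose f (x : flag D) := porbit (face_perm dirE) (side x).
have fside a h h' s s' : f (a, h, s) = f (a, h', s').
  have e := negPn (same a).
  by apply/eqP; rewrite /f /side /=; case: s s' => [] [];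
    rewrite ?eqxx // ?eq_porbit_mem // porbit_sym.
have fvert x y : flag_vertex x = flag_vertex y -> f x = f y.
  move/eqP; rewrite -(corner_vertex E); apply: connect_inv => {}x z /orP[]/eqP->.
    by rewrite /f porbit_corner.
  by case: x => [[a h] s]; apply: fside.
have fall a b : f (a, false, false) = f (b, false, false).
  have := connect_cycle cyc (allc a) (allc b).
  apply: (@connect_inv _ _ _ (fun a => f (a, false, false))) => {}a {}b /eqP ab.
  by rewrite -(fvert (a, true, false) (b, false, false)) //; apply: fside.
apply/card_le1_eqP => _ _ /imsetP[[b s'] _ ->] /imsetP[[a s] _ ->].
rewrite -[LHS]/(f (a, false, s)) -[RHS]/(f (b, false, s')).
by rewrite (fside a false false s false) (fall a b); apply: fside.
Qed.

(* On one side of each arc, corners follow the euler circuit; on the other they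
   follow it after a rotation [r] of the arcs entering each vertex, so that
   going around a vertex visits its entering arcs in the cyclic order [r]. *)
Lemma exists_directed_emb {D : digraph} :
  eulerian D -> exists E : embedding D, directed_emb E.
Proof.
move=> /eulerian_cycle[c [cyc Uc allc]].
have [r rP] := fiber_rotation _ _ (@tgt D).
pose nxt := perm (can_inj (prev_next Uc)).
have nxtP a : src (nxt a) = tgt a.
  by rewrite permE; apply/esym/eqP; rewrite (next_cycle cyc).
have tgt_r a : tgt (r a) = tgt a by apply/esym/eqP; rewrite -rP fconnect1.
pose nx (s : bool) : {perm darc D} := if s then (r * nxt)%g else nxt.
have nxP s a : src (nx s a) = tgt a by case: s; rewrite /= ?permM nxtP ?tgt_r.
pose cor (x : flag D) : flag D := let: (a, h, s) := x in
  if h then (nx s a, false, s) else ((nx s)^-1%g a, true, s).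
have corK : involutive cor by case=> [[a []] s] /=; rewrite ?permK ?permKV.
have cor_neq x : cor x != x.
  by case: x => [[a []] s]; apply/eqP => /(congr1 (fun y : flag D => y.1.2)).
have cor_src x : flag_vertex (cor x) = flag_vertex x.
  by case: x => [[a []] s] /=; rewrite ?nxP // -(nxP s) permKV.
have sK := adj2_connect_sym corK (@acrossK D).
(* Every flag is linked to a head on side [false] at its vertex, so only these heads remain to be
   connected. *)
have cor_head x : exists2 a,
    connect (adj2 cor (@across D)) x (a, true, false) & flag_vertex x = tgt a.
  have head a (s : bool) : connect (adj2 cor (@across D)) (a, true, s) (a, true, false).
    by case: s => //; apply: connect_adj2r.
  case: x => [[a []] s]; first by exists a.
  exists ((nx s)^-1%g a); last by rewrite -(cor_src (a, false, s)).
  by apply: connect_trans (head _ s); apply: connect_adj2l.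
(* The path crosses the head of [a], takes the corner to [nxt (r a)] on side [true], crosses its
   tail, and takes the corner back to the head of [r a] on side [false]. *)
have cor_r a : connect (adj2 cor (@across D)) (a, true, false) (r a, true, false).
  apply: connect_trans (connect_adj2r _) _.
  apply: connect_trans (connect_adj2l _) _.
  apply: connect_trans (connect_adj2r _) _.
  apply: connect_trans (connect_adj2l _) _.
  by rewrite /= permM permK.
have corP x y : connect (adj2 cor (@across D)) x y = (flag_vertex x == flag_vertex y).
  apply/idP/idP => [xy|].
    apply/eqP; apply: connect_inv xy => {}x {}y /orP[]/eqP->.
      by rewrite cor_src.
    by rewrite across_vertex.
  have [[a xa ->] [b yb ->]] := (cor_head x, cor_head y).
  rewrite -rP => ab; apply: connect_trans xa _; rewrite sK; apply: connect_trans yb _.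
  rewrite sK; case/connectP: ab => p + ->; elim: p a => //= d p IHp a.
  by move=> /andP[/eqP<- /IHp]; apply: connect_trans (cor_r a).
exists (Embedding corK cor_neq corP); apply/directed_embP => x /=.
by case: x => [[a []] s].
Qed.

(** * Lowering the number of faces *)

(** Each twist of a separating arc removes one face. As [k] is strictly below the initial count, at
    least one twist is made, and the last one gives nonorientability. *)
Lemma directed_emb_between {D : digraph} (E : embedding D) (k : nat) :
  eulerian D -> directed_emb E -> (0 < k < #|faces E|)%N ->
  exists E' : embedding D,
    [/\ directed_emb E', ~~ orientable E' & #|faces E'| = k].
Proof.
move=> euD; move tE: #|faces E| => t; elim: t E tE => [|t IHt] E tE dirE.
  by rewrite ltn0 andbF.
move=> /andP[k0]; rewrite ltnS => kt.
have [|a sep] := separating_arc dirE euD; first by rewrite tE ltnS (leq_trans k0).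
have [] := twist_merge _ _ _ sep; rewrite tE => -[tE'] nonor.
have dirE' := twist_directed a E dirE.
move: kt; rewrite leq_eqVlt => /orP[/eqP kt|kt].
  by exists (twist a E); rewrite -tE' kt.
by apply: IHt (esym tE') dirE' _; rewrite k0.
Qed.

Lemma faces_gt0 {D : digraph} (E : embedding D) :
  (0 < #|darc D|)%N -> (0 < #|faces E|)%N.
Proof.
by case/card_gt0P=> a _; apply/card_gt0P; eexists; apply: (imset_f _ (x := (a, true, true))).
Qed.

Lemma nfaces_arcs {D : digraph} (E : embedding D) :
  eulerian D -> (0 < #|darc D|)%N -> nfaces E = #|faces E|.
Proof. by move=> euD m0; rewrite /nfaces eulerian_isolated // cards0 addn0. Qed.

Lemma nfaces_no_arc {D : digraph} (E : embedding D) :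
  eulerian D -> #|darc D| = 0%N -> nfaces E = 1%N.
Proof.
move=> euD m0; have [n1 isoT] := eulerian_no_arc euD m0.
rewrite /nfaces isoT cardsT n1 (_ : faces E = set0) ?cards0 //.
apply/setP=> F; rewrite inE; apply/imsetP => -[[[a h] s] _ _].
by have := card0_eq m0 a.
Qed.

Lemma nfaces_gt0 {D : digraph} (E : embedding D) : eulerian D -> (0 < nfaces E)%N.
Proof.
move=> euD; have [m0|m0] := posnP #|darc D|; first by rewrite nfaces_no_arc.
by rewrite nfaces_arcs // faces_gt0.
Qed.

Lemma directed_nonor_emb_between {D : digraph} (E : embedding D) (k : nat) :
  eulerian D -> directed_emb E -> (0 < k < nfaces E)%N ->
  exists E' : embedding D,
    [/\ directed_emb E', ~~ orientable E' & nfaces E' = k].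
Proof.
move=> euD dirE; have [m0|m0] := posnP #|darc D|; first by rewrite nfaces_no_arc //; lia.
rewrite nfaces_arcs // => /(directed_emb_between _ _ euD dirE)[E' [dirE' nonor kE']].
by exists E'; rewrite nfaces_arcs.
Qed.

(** Both sides of any arc lie on the only face. *)
Lemma one_face_nonorientable {D : digraph} (E : embedding D) :
  (0 < #|darc D|)%N -> directed_emb E -> (#|faces E| <= 1)%N -> ~~ orientable E.
Proof.
case/card_gt0P=> a _ dirE; rewrite (card_faces dirE) => /card_le1_eqP one.
apply: (@directed_nonorientable _ _ dirE a); rewrite -eq_porbit_mem; apply/eqP.
by apply: one; apply: imset_f.
Qed.

(** * Genera *)

Local Open Scope ring_scope.

(** Halving rounds down in the orientable case; otherwise equality holds. *)
Lemma euler_genus_le {D : digraph} (E : embedding D) :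
  euler_genus E <= 2 - euler_char E.
Proof. by rewrite /euler_genus /genus; case: orientable => //; lia. Qed.


Theorem theorem7p3 (D : digraph) (n m : nat)
    (hn : #|vert D| = n) (hm : #|darc D| = m) (hD : eulerian D) :
  [/\ (forall t : nat,
         (exists E : embedding D, directed_emb E /\ nfaces E = t) ->
         forall s : nat, (1 <= s < t)%N ->
           exists E : embedding D,
             [/\ directed_emb E, ~~ orientable E & nfaces E = s]),
      (forall g1 g2 g : int,
         nonor_directed_genus D g1 -> nonor_directed_genus D g2 ->
         g1 <= g <= g2 -> nonor_directed_genus D g),
      (m = 0%N ->
         exists E : embedding D,
           [/\ directed_emb E, planar E, nfaces E = 1%N
             & forall E' : embedding D, directed_emb E' -> emb_equiv E' E])
    & ((0 < m)%N ->
         (exists E : embedding D, directed_emb E /\ nfaces E = 1%N) /\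
         (forall E : embedding D, directed_emb E -> nfaces E = 1%N ->
            [/\ ~~ orientable E,
                genus E = m%:Z - n%:Z + 1,
                (forall E' : embedding D,
                   directed_emb E' -> ~~ orientable E' -> genus E' <= genus E)
              & (forall E' : embedding D,
                   directed_emb E' -> euler_genus E' <= euler_genus E)]))].
Proof.
split=> [t [E [dirE <-]] s st|g1 g2 g [E1 [dir1 non1 <-]] [E2 [dir2 non2 <-]]||].
- exact: directed_nonor_emb_between st.
- rewrite /genus (negPf non1) (negPf non2) => /andP[g1g gg2].
  (* Genus [g1] is realised by [E1] itself; a larger one asks for strictly fewer faces than [E1]
     has. *)
  have [|gg1] := eqVneq g (2 - euler_char E1).
    by move=> ->; exists E1; rewrite /genus (negPf non1).
  have := nfaces_gt0 E2 hD; rewrite /euler_char in g1g gg2 gg1 => n2.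
  (* The face count that Euler's formula prescribes for [g]; it is positive because [g] is at most
     the genus of [E2], which has a face. *)
  pose k := absz (2 - g - (#|vert D|%:Z - #|darc D|%:Z))%R.
  have [|E [dirE nonE kE]] := directed_nonor_emb_between E1 k hD dir1.
    by rewrite /k; lia.
  exists E; split=> //; rewrite /genus (negPf nonE) /euler_char kE /k; lia.
- move=> m0; rewrite m0 in hm; have no_arc (a : darc D) : False by have := card0_eq hm a.
  have [E dirE] := exists_directed_emb hD.
  (* Without flags any colouring will do, and below any relabelling. *)
  have orE : orientable E by apply/existsP; exists [ffun=> true]; apply/forallP=> -[[a]].
  have E1 := nfaces_no_arc E hD hm; exists E; split=> //.
    split=> //; rewrite /genus orE /euler_char E1 hm.
    by have [-> _] := eulerian_no_arc hD hm.
  by move=> E' _; exists (fun=> true) => -[[a]].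
- rewrite -hm => m0; split=> [|E dirE E1].
    have [E dirE] := exists_directed_emb hD.
    have [E1|E1] := eqVneq (nfaces E) 1%N; first by exists E.
    have [|E' [dirE' _ E'1]] := directed_nonor_emb_between E 1 hD dirE; last by exists E'.
    by have := nfaces_gt0 E hD; lia.
  have nonE : ~~ orientable E.
    by apply: one_face_nonorientable; rewrite // -(nfaces_arcs E hD m0) E1.
  have genusE : genus E = 2 - euler_char E by rewrite /genus (negPf nonE).
  (* Every embedding has at least one face, so one face gives the least Euler characteristic. *)
  have le_char (E' : embedding D) : 2 - euler_char E' <= genus E.
    by have := nfaces_gt0 E' hD; rewrite genusE /euler_char E1; lia.
  split=> // [|E' _ nonE'|E' _].
  - by rewrite genusE /euler_char E1 hn; lia.
  - by rewrite {1}/genus (negPf nonE').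
  - by rewrite [leRHS]/euler_genus (negPf nonE); apply: le_trans (euler_genus_le E') _.
Qed.
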